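(* Let $Z$ be the generator of an $lC_0$-semigroup in a sequentially complete (Hausdorff) locally convex space $\mathbf{X}$ and let $D$ be a core of the generator $Z$. Assume that there exists a function $F\in\mathcal{F}_{\mathbf{X}}$ such that $F'_{ef}(0)f=Zf$ for each $f\in D$ (in particular $D\subset\mathcal{D}(F'_{ef}(0))$). Then for all $f\in\mathbf{X}$, $F(t/n)^nf$ converges to $\exp(tZ)f$ as $n\to\infty$ uniformly with respect to $t\in[0,t_0]$ for any $t_0>0$.
   Context: $\mathbf{X}$ is over $\mathbb{T}\in\{\mathbb{R},\mathbb{C}\}$ with topology generated by semi-norms $\|\cdot\|_\alpha$, $\alpha\in\Omega$. $\mathcal{L}(\mathbf{X})$ is the space of bounded linear operators in $\mathbf{X}$ with the topology of pointwise convergence; $I$ is the identity; $\mathcal{D}(C)$ is the domain of $C$. A family $G_\beta\in\mathcal{L}(\mathbf{X})$, $\beta\in\Gamma$, is equicontinuous if for any $\alpha\in\Omega$ there are finitely many $\alpha_1,\dots,\alpha_n\in\Omega$ and $b_1,\dots,b_n>0$ with $\sup_\beta\|G_\beta x\|_\alpha\le\sum_i b_i\|x\|_{\alpha_i}$ for all $x\in\mathbf{X}$. For $F:[0,\infty)\to\mathcal{L}(\mathbf{X})$ and $s\ge0$ put $\mathbf{B}^F_s=\{F(\tfrac dn)^m : md/n\le s,\ n,m\in\mathbb{N},\ d\ge0\}$. $\mathcal{E}_{\mathbf{X}}$ is the set of $F:[0,\infty)\to\mathcal{L}(\mathbf{X})$ with $F(0)=I$ and $\mathbf{B}^F_s$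 equicontinuous for every $s\ge0$. Many-valued effective derivative: $\mathcal{D}(F'_{mef}(0))$ is the set of $f\in\mathbf{X}$ for which there is a family $\{f_s\}_{s\ge0}$ in $\mathbf{X}$ such that $\lim_{h\to0}f_h=f$ and $\lim_{h\to0}h^{-1}(F(h)-F(0))f_h$ exists (limits as $h\to 0$, $h>0$); $F'_{mef}(0)f$ is the set of all $g\in\mathbf{X}$ arising as the second limit for some such family. $\mathcal{F}_{\mathbf{X}}$ is the set of $F\in\mathcal{E}_{\mathbf{X}}$ with $\mathcal{D}(F'_{mef}(0))$ dense in $\mathbf{X}$. For $F\in\mathcal{F}_{\mathbf{X}}$ each $F'_{mef}(0)f$ consists of one element, and the effective derivative $F'_{ef}(0):\mathcal{D}(F'_{mef}(0))\to\mathbf{X}$ is the linear map with $F'_{ef}(0)f\in F'_{mef}(0)f$. An $lC_0$-semigroup is a continuous function $T:[0,\infty)\to\mathcal{L}(\mathbf{X})$ with $T(0)=I$, $T(l+m)=T(l)T(m)$ for $l,m\ge0$, and $T\in\mathcal{E}_{\mathbf{X}}$. Its generator is the operator $Z\psi=\lim_{h\to0}h^{-1}(T(h)\psi-\psi)$ with domain the set of all $\psi$ for which the limit exists; one writes $T(t)=\exp(tZ)$ (a generator determines its semigroup). A set $D\subset\mathcal{D}(Z)$ is a core of the generator $Z$ if the closure of $\{(x,Zx):x\in D\}$ in $\mathbf{X}\times\mathbf{X}$ equals the graph of $Z$. *)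

(* Defs.v *)
From HB Require Import structures.
From mathcomp Require Import all_boot all_order all_algebra.
From mathcomp Require Import complex.
From mathcomp Require Import boolp classical_sets functions reals topology.
From mathcomp Require Import normedtype sequences.

Set Implicit Arguments.
Unset Strict Implicit.
Unset Printing Implicit Defensive.

Import Order.TTheory GRing.Theory Num.Theory.
Import numFieldNormedType.Exports.

Local Open Scope classical_set_scope.
Local Open Scope ring_scope.

Variant scalars := RealScalars | ComplexScalars.

Definition scalar_field (R : realType) (k : scalars) : numFieldType :=
  match k with RealScalars => R | ComplexScalars => R[i] end.

Definition of_real (R : realType) (k : scalars) : R -> scalar_field R k :=
  match k return R -> scalar_field R k with
  | RealScalars => fun r => r
  | ComplexScalars => fun r => r%:C%C
  end.

(* A (possibly unbounded) operator in X; the values of [op_fun] outside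
   [op_dom] are irrelevant. *)
Record operator (X : Type) := Operator {
  op_dom : set X;
  op_fun :> X -> X }.

Definition graph (X : Type) (Z : X -> X) (D : set X) : set (X * X) :=
  [set (x, Z x) | x in D].

Section LocallyConvex.
Context {R : realType} {k : scalars} {X : tvsType (scalar_field R k)}.
Context {Omega : Type}.
Implicit Types (p : Omega -> X -> R) (F T : R -> X -> X) (Z : operator X).

(* The norm of a scalar lives in [scalar_field R k], hence the coercions. *)
Definition seminorm (q : X -> R) : Prop :=
  (forall x y, q (x + y) <= q x + q y) /\
  (forall (a : scalar_field R k) x,
     of_real k (q (a *: x)) = `|a| * of_real k (q x)).

(* The condition is on entourages and not only on neighbourhoods: a [tvsType]
   does not require its uniformity to be the translation invariant one, on
   which Cauchy sequences and uniform convergence in X are to be based. *)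
Definition generated_by p : Prop :=
  (forall alpha, seminorm (p alpha)) /\
  (forall A : set (X * X), entourage A <->
     exists (n : nat) (a : 'I_n -> Omega) (e : R), 0 < e /\
       [set xy : X * X | forall i, p (a i) (xy.1 - xy.2) < e] `<=` A).

Definition sequentially_complete : Prop :=
  forall u : nat -> X, cauchy (u @ \oo) -> exists l : X, u @ \oo --> l.

Definition equicontinuous_family p (B : set (X -> X)) : Prop :=
  forall alpha, exists (n : nat) (a : 'I_n -> Omega) (b : 'I_n -> R),
    (forall i, 0 < b i) /\
    forall G, B G -> forall x, p alpha (G x) <= \sum_(i < n) b i * p (a i) x.

(* Whichever notion of boundedness is chosen here is immaterial for members of
   [calE], where equicontinuity gives the seminorm estimates anyway. *)
Definition bounded_linear p (G : X -> X) : Prop :=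
  linear G /\ equicontinuous_family p [set G].

(* A function [0, oo) -> L(X) is a function on R whose values at negative
   arguments are ignored. *)
Definition power_family F (s : R) : set (X -> X) :=
  [set G | exists (n m : nat) (d : R),
     [/\ (0 < n)%N, (0 < m)%N, 0 <= d, m%:R * d / n%:R <= s
       & G = iter m (F (d / n%:R))]].

Definition calE p : set (R -> X -> X) :=
  [set F | [/\ forall t, 0 <= t -> bounded_linear p (F t),
               F 0 = id
             & forall s, 0 <= s -> equicontinuous_family p (power_family F s)]].

Definition mef F (f : X) : set X :=
  [set g | exists u : R -> X,
     u h @[h --> 0^'+] --> f /\
     of_real k h^-1 *: (F h (u h) - F 0 (u h)) @[h --> 0^'+] --> g].

Definition mef_dom F : set X := [set f | mef F f !=set0].

Definition calF p : set (R -> X -> X) :=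
  [set F | calE p F /\ dense (mef_dom F)].

(* [xget] selects the element of [mef F f], unique for F in [calF p]. *)
Definition effective_derivative F : operator X :=
  Operator (mef_dom F) (fun f => xget 0 (mef F f)).

Definition lC0_semigroup p T : Prop :=
  [/\ {within [set t : R | 0 <= t], continuous (T : R -> {ptws X -> X})},
      T 0 = id,
      forall l m : R, 0 <= l -> 0 <= m -> T (l + m) = T l \o T m
    & calE p T].

Definition is_generator T Z : Prop :=
  let quotient psi h := of_real k h^-1 *: (T h psi - psi) in
  op_dom Z = [set psi | exists g : X, quotient psi h @[h --> 0^'+] --> g] /\
  forall psi, op_dom Z psi -> quotient psi h @[h --> 0^'+] --> Z psi.

Definition is_core Z (D : set X) : Prop :=
  D `<=` op_dom Z /\ closure (graph Z D) = graph Z (op_dom Z).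

End LocallyConvex.

Arguments sequentially_complete {R k} X.

(* Main.v *)
Require Import Defs.
From HB Require Import structures.
From mathcomp Require Import all_boot all_order all_algebra.
From mathcomp Require Import complex.
From mathcomp Require Import ring lra.
From mathcomp Require Import boolp classical_sets functions reals topology.
From mathcomp Require Import normedtype sequences.
Import Order.TTheory GRing.Theory Num.Theory.
Import numFieldNormedType.Exports.
Local Open Scope classical_set_scope.
Local Open Scope ring_scope.

Set Implicit Arguments.
Unset Strict Implicit.
Unset Printing Implicit Defensive.

(** Write T(t) = exp(tZ).  For g in the domain of Z fix a mesh d and use the
    core to choose, for every small h, vectors w_i close to T(i d)g with
    F(h)w_i - w_i = h T(i d)Zg + o(h): they are members at h of the families
    in the definition of the effective derivative.  Although w_i approaches
    T(i d)g at no rate in h, the polygonal path v through the w_i has slope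
    close to Zv because the mesh does not depend on h, so F(h)v_j - v_(j+1) is
    small compared to h.  Telescoping with the equicontinuity of the powers of
    F(h) gives F(h)^n g close to T(nh)g, with no use of resolvents.  Sequential
    completeness only serves to show that the domain of Z is dense, by means
    of limits of averages of T(t)f over dyadic points of [0, a]. *)

Lemma subrACA (V : zmodType) (x y z t : V) :
  (x - y) - (z - t) = (x - z) - (y - t).
Proof. by rewrite !opprB [t - z]addrC addrACA [- y + t]addrC. Qed.

(** * Embedding of the reals into the scalar field *)

Section RealScalars.
Context {R : realType} {k : scalars}.

Lemma of_real_zmod_morphism : zmod_morphism (@of_real R k).
Proof. by case: k => a b //=; rewrite rmorphB. Qed.

Lemma of_real_monoid_morphism : monoid_morphism (@of_real R k).
Proof. by case: k; split => //= a b; rewrite rmorphM. Qed.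

HB.instance Definition _ :=
  GRing.isZmodMorphism.Build R (scalar_field R k) (@of_real R k)
    of_real_zmod_morphism.
HB.instance Definition _ :=
  GRing.isMonoidMorphism.Build R (scalar_field R k) (@of_real R k)
    of_real_monoid_morphism.

Lemma norm_of_real (a : R) : `|of_real k a| = of_real k `|a|.
Proof. by case: k => //=; rewrite normc_def /= expr0n addr0 sqrtr_sqr. Qed.

End RealScalars.

(** * The uniformity of [X] through finite sums of seminorms *)

Section Seminorms.
Context {R : realType} {k : scalars} {X : tvsType (scalar_field R k)}.
Context {Omega : Type} {p : Omega -> X -> R}.
Context (p_gen : generated_by p).
Implicit Types (x y z : X) (a b : R) (s : seq Omega).

Definition rscale a x : X := of_real k a *: x.
Local Notation "a *.: x" := (rscale a x) (at level 40).

Lemma rscaleDl a b x : (a + b) *.: x = a *.: x + b *.: x.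
Proof. by rewrite /rscale rmorphD scalerDl. Qed.

Lemma rscaleBl a b x : (a - b) *.: x = a *.: x - b *.: x.
Proof. by rewrite /rscale rmorphB scalerBl. Qed.

Lemma rscaleBr a x y : a *.: (x - y) = a *.: x - a *.: y.
Proof. exact: scalerBr. Qed.

Lemma rscaleA a b x : a *.: (b *.: x) = (a * b) *.: x.
Proof. by rewrite /rscale scalerA rmorphM. Qed.

Lemma rscale1 x : 1 *.: x = x.
Proof. by rewrite /rscale rmorph1 scale1r. Qed.

Lemma rscale0 x : 0 *.: x = 0.
Proof. by rewrite /rscale rmorph0 scale0r. Qed.

(* The sums [sumsn s], over lists which may repeat an index, are a directed
   basis of continuous seminorms, and repetition absorbs multiplicative
   constants: equicontinuity reads [sumsn s (G x) <= sumsn s' x]. *)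
Definition sumsn s x : R := \sum_(i <- s) p i x.

Lemma seminormD i x y : p i (x + y) <= p i x + p i y.
Proof. exact: (p_gen.1 i).1. Qed.

Lemma seminorm_rscale i a x : p i (a *.: x) = `|a| * p i x.
Proof.
have inj : injective (@of_real R k) by exact: fmorph_inj.
by apply: inj; rewrite (p_gen.1 i).2 norm_of_real rmorphM.
Qed.

Lemma sumsnZ s a x : sumsn s (a *.: x) = `|a| * sumsn s x.
Proof.
by rewrite /sumsn mulr_sumr; apply: eq_bigr => i _; exact: seminorm_rscale.
Qed.

Lemma sumsnD s x y : sumsn s (x + y) <= sumsn s x + sumsn s y.
Proof.
by rewrite /sumsn -big_split; apply: ler_sum => i _; exact: seminormD.
Qed.

Lemma sumsn0 s : sumsn s 0 = 0.
Proof. by rewrite -(rscale0 0) sumsnZ normr0 mul0r. Qed.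

Lemma sumsnN s x : sumsn s (- x) = sumsn s x.
Proof.
have -> : - x = (-1) *.: x by rewrite /rscale rmorphN rmorph1 scaleN1r.
by rewrite sumsnZ normrN1 mul1r.
Qed.

Lemma sumsn_ge0 s x : 0 <= sumsn s x.
Proof.
have := sumsnD s x (- x); rewrite subrr sumsn0 sumsnN; lra.
Qed.

Lemma sumsnB s x y : sumsn s (x - y) <= sumsn s x + sumsn s y.
Proof. by have := sumsnD s x (- y); rewrite sumsnN. Qed.

Lemma sumsnC s x y : sumsn s (x - y) = sumsn s (y - x).
Proof. by rewrite -sumsnN opprB. Qed.

Lemma sumsn_dist s x y z : sumsn s (x - z) <= sumsn s (x - y) + sumsn s (y - z).
Proof. by have := sumsnD s (x - y) (y - z); rewrite addrA subrK. Qed.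

Lemma sumsn_cat s t x : sumsn (s ++ t) x = sumsn s x + sumsn t x.
Proof. by rewrite /sumsn big_cat. Qed.

Lemma sumsn_sum s (I : Type) (r : seq I) (f : I -> X) :
  sumsn s (\sum_(i <- r) f i) <= \sum_(i <- r) sumsn s (f i).
Proof.
apply: (big_ind2 (fun x a => sumsn s x <= a)) => [|x a y b xa yb|//].
  by rewrite sumsn0.
by apply: le_trans (sumsnD _ _ _) _; exact: lerD.
Qed.

(** A finite sum dominates each of its terms, and it is below [e] as soon as each term is below [e]
    divided by one more than the length; the extra one also serves the empty list. *)
Lemma entourage_sumsn (A : set (X * X)) : entourage A <->
  exists s e, 0 < e /\ [set xy : X * X | sumsn s (xy.1 - xy.2) < e] `<=` A.
Proof.
have p_ge0 i x : 0 <= p i x.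
  by have := sumsn_ge0 [:: i] x; rewrite /sumsn big_seq1.
rewrite (p_gen.2 A); split.
  move=> [n [a [e [e0 sA]]]]; exists [seq a i | i <- enum 'I_n], e; split=> //.
  move=> xy /= xye; apply: sA => /= i; apply: le_lt_trans xye.
  rewrite /sumsn big_map big_enum /= (bigD1 i)//=.
  by rewrite lerDl sumr_ge0.
move=> [s [e [e0 sA]]].
exists (size s), (tnth (in_tuple s)), (e / (size s).+1%:R); split.
  by rewrite divr_gt0.
move=> xy /= xye; apply: sA => /=.
rewrite /sumsn big_tnth.
have: \sum_(i < size s) p (tnth (in_tuple s) i) (xy.1 - xy.2) <=
    \sum_(i < size s) (e / (size s).+1%:R).
  by apply: ler_sum => i _; exact/ltW.
move/le_lt_trans; apply.
rewrite sumr_const card_ord -[_ *+ _]mulr_natr mulrAC ltr_pdivrMr//.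
by rewrite ltr_pM2l// ltr_nat.
Qed.

Lemma nbhs_sumsn x (A : set X) : nbhs x A <->
  exists s e, 0 < e /\ [set y | sumsn s (y - x) < e] `<=` A.
Proof.
rewrite nbhsP; split.
  move=> [B /entourage_sumsn[s [e [e0 sB]]] BA]; exists s, e.
  split=> // y /= ye.
  by apply/BA/xsectionP/sB; rewrite /= sumsnC.
move=> [s [e [e0 sA]]]; exists [set xy | sumsn s (xy.1 - xy.2) < e].
  by apply/entourage_sumsn; exists s, e; split.
by move=> y /xsectionP /= xy; apply: sA; rewrite /= sumsnC.
Qed.

Lemma cvg_sumsn (T : Type) (G : set_system T) (u : T -> X) x : Filter G ->
  u y @[y --> G] --> x <->
  forall s e, 0 < e -> \forall y \near G, sumsn s (u y - x) < e.
Proof.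
move=> FG; split=> [ux s e e0|ux A /nbhs_sumsn[s [e [e0 sA]]]].
  apply: (ux [set y | sumsn s (y - x) < e]).
  by apply/nbhs_sumsn; exists s, e; split.
by apply: filterS (ux s e e0) => y; exact: sA.
Qed.

Lemma equicontinuous_sumsn (B : set (X -> X)) : equicontinuous_family p B ->
  forall s, exists s', forall G, B G -> forall x, sumsn s (G x) <= sumsn s' x.
Proof.
move=> eqB; elim=> [|i s [s' s'P]].
  by exists [::] => G _ x; rewrite /sumsn !big_nil.
have [n [a [b [b0 abP]]]] := eqB i.
(* The index [a j] is listed more than [b j] times; [s'] serves the tail by induction. *)
exists (flatten [seq nseq (Num.truncn (b j)).+1 (a j) | j <- enum 'I_n] ++ s').
move=> G BG x; rewrite sumsn_cat /sumsn big_cons -/(sumsn s (G x)).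
apply: lerD; last exact: s'P.
apply: le_trans (abP G BG x) _.
rewrite big_flatten big_map big_enum /=; apply: ler_sum => j _.
rewrite big_cons big_nseq iter_addr addr0 -mulrS -mulr_natl ler_wpM2r//;
  last exact/ltW/truncnS_gt.
by have := sumsn_ge0 [:: a j] x; rewrite /sumsn big_seq1.
Qed.

End Seminorms.

(** * Limits at zero from the right, linear maps and their powers *)

Section Operators.
Context {R : realType} {k : scalars} {X : tvsType (scalar_field R k)}.
Context {Omega : Type} {p : Omega -> X -> R}.
Context (p_gen : generated_by p).
Implicit Types (x y z f : X) (a b e h t S : R) (s : seq Omega).

Lemma near_at_right0 (P : R -> Prop) : (\forall h \near 0^'+, P h) <->
  exists d : R, 0 < d /\ forall h, 0 < h < d -> P h.
Proof.
split=> [/nbhs_ballP[d /= d0 dP]|[d [d0 dP]]].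
  exists d; split=> // h /andP[h0 hd]; apply: dP => //=.
  by rewrite /ball /= sub0r normrN gtr0_norm.
apply/nbhs_ballP; exists d => //= h; rewrite /ball /= sub0r normrN => hd h0.
by apply: dP; rewrite h0 (le_lt_trans (ler_norm _) hd).
Qed.

Lemma cvg_at_right0_sumsn (u : R -> X) x : u h @[h --> 0^'+] --> x <->
  forall s e, 0 < e ->
    exists d : R, 0 < d /\ forall h, 0 < h < d ->
      sumsn (p := p) s (u h - x) < e.
Proof.
rewrite (cvg_sumsn p_gen); split=> ux s e e0; apply/near_at_right0; exact: ux.
Qed.

Section Linear.
Context {G : X -> X} (linG : linear G).

Lemma linear0_of : G 0 = 0.
Proof.
have := linG 1 0 0; rewrite !scale1r addr0 => /(congr1 (fun z => z - G 0)).
by rewrite subrr addrK => <-.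
Qed.

Lemma linearD_of x y : G (x + y) = G x + G y.
Proof. by have := linG 1 x y; rewrite !scale1r. Qed.

Lemma linear_rscale a x : G (rscale a x) = rscale a (G x).
Proof. by have := linG (of_real k a) x 0; rewrite linear0_of !addr0. Qed.

Lemma linearB_of x y : G (x - y) = G x - G y.
Proof. by apply/(addIr (G y)); rewrite -linearD_of !subrK. Qed.

Lemma linear_iter m : linear (iter m G).
Proof. by elim: m => [//|m IH] a x y; rewrite !iterS IH linG. Qed.

Lemma linear_sum_of (I : Type) (r : seq I) (f : I -> X) :
  G (\sum_(i <- r) f i) = \sum_(i <- r) G (f i).
Proof. exact: (big_morph G linearD_of linear0_of). Qed.

End Linear.

(** The difference is the sum over [j < n] of [iter (n - j.+1) G (G (v j) - v j.+1)], and every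
    power of [G] occurring there is controlled by [s']. *)
Lemma iter_telescope (G : X -> X) s s' n (v : nat -> X) : linear G ->
  (forall m x, (m <= n)%N ->
     sumsn (p := p) s (iter m G x) <= sumsn (p := p) s' x) ->
  sumsn (p := p) s (iter n G (v 0%N) - v n) <=
    \sum_(j < n) sumsn (p := p) s' (G (v j) - v j.+1).
Proof.
move=> linG Gs.
suff H m : (m <= n)%N ->
    sumsn (p := p) s (iter n G (v 0%N) - iter (n - m) G (v m)) <=
      \sum_(j < m) sumsn (p := p) s' (G (v j) - v j.+1).
  by have := H n (leqnn n); rewrite subnn.
elim: m => [|m IH] mn; first by rewrite subn0 subrr sumsn0// big_ord0.
rewrite big_ord_recr /=.
apply: le_trans (sumsn_dist p_gen _ _ (iter (n - m) G (v m)) _) _.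
apply: lerD; first exact/IH/ltnW.
rewrite -(subnSK mn) iterSr -(linearB_of (linear_iter linG _)).
by apply: Gs; rewrite leq_subr.
Qed.

Lemma calE_linear F t : calE p F -> 0 <= t -> linear (F t).
Proof. by move=> [FE _ _] t0; case: (FE t t0). Qed.

Lemma calE_sumsn F S s : calE p F -> 0 <= S -> exists s', forall n m t,
  (0 < n)%N -> (m <= n)%N -> 0 <= t <= S ->
  forall x, sumsn (p := p) s (iter m (F (t / n%:R)) x) <= sumsn (p := p) s' x.
Proof.
move=> [_ _ /(_ S) + S0].
move=> /(_ S0) /(equicontinuous_sumsn p_gen) /(_ s)[s' s'P].
(* The powers in [power_family] have positive exponent; [s] covers the case [m = 0]. *)
exists (s ++ s') => n m t n0 mn /andP[t0 tS] x; rewrite sumsn_cat.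
case: m mn => [|m] mn; first by rewrite lerDl sumsn_ge0.
rewrite (le_trans (s'P _ _ x)) ?lerDr ?sumsn_ge0//.
exists n, m.+1, t; split=> //.
by rewrite (le_trans _ tS)// ler_pdivrMr ?ltr0n// mulrC ler_wpM2l// ler_nat.
Qed.

End Operators.

(** * Riemann sums along the orbits of the semigroup *)

Section Semigroup.
Context {R : realType} {k : scalars} {X : tvsType (scalar_field R k)}.
Context {Omega : Type} {p : Omega -> X -> R}.
Context (p_gen : generated_by p).
Context {T : R -> X -> X} (T_semigroup : lC0_semigroup p T).
Implicit Types (x y z f : X) (a b c e h t S : R) (s : seq Omega).
Implicit Types (n m K N : nat).
Local Notation "a *.: x" := (rscale a x) (at level 40).
Local Notation sumsn := (sumsn (p := p)).

Lemma sumsn_BB s x y z f :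
  sumsn s ((x - y) - (z - f)) <= sumsn s (x - z) + sumsn s (y - f).
Proof. by rewrite subrACA sumsnB. Qed.

Lemma semigroup0 f : T 0 f = f.
Proof. by have [_ -> _ _] := T_semigroup. Qed.

Lemma semigroupD t h f : 0 <= t -> 0 <= h -> T (t + h) f = T t (T h f).
Proof. by move=> t0 h0; have [_ _ TD _] := T_semigroup; rewrite TD. Qed.

Lemma semigroup_linear t : 0 <= t -> linear (T t).
Proof. by have [_ _ _ TE] := T_semigroup => t0; exact: (calE_linear TE t0). Qed.

Lemma semigroup_continuous0 f s e : 0 < e -> exists d : R, 0 < d /\
  forall h, 0 <= h < d -> sumsn s (T h f - f) < e.
Proof.
have [/subspace_continuousP T_cont _ _ _] := T_semigroup.
move=> e0; have /T_cont : [set t : R | 0 <= t] 0 by rewrite /= lexx.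
move=> /pointwise_cvgP /(_ f) /(cvg_sumsn p_gen) /(_ s e e0).
move=> /nbhs_ballP[d /= d0 dP]; exists d; split=> // h /andP[h0 hd].
rewrite -[X in _ - X]semigroup0; apply: dP => //=.
by rewrite /ball /= sub0r normrN ger0_norm.
Qed.

Lemma semigroup_sumsn S s : 0 <= S -> exists s', forall t, 0 <= t <= S ->
  forall x, sumsn s (T t x) <= sumsn s' x.
Proof.
have [_ _ _ TE] := T_semigroup.
move=> /(calE_sumsn p_gen s TE)[s' s'P]; exists s' => t tS x.
by have /= := s'P 1%N 1%N t isT isT tS x; rewrite divr1.
Qed.

(** Left-endpoint sum without its factor [d]: multiplied by [d], it approximates the integral of
    [T u f] over [0 <= u <= n * d]. *)
Definition riemann (d : R) n f : X := \sum_(j < n) T (j%:R * d) f.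

Lemma riemannD d m n f : 0 <= d ->
  riemann d (m + n) f = riemann d m f + T (m%:R * d) (riemann d n f).
Proof.
move=> d0; rewrite /riemann big_split_ord /=; congr (_ + _).
rewrite (linear_sum_of (semigroup_linear _)) ?mulr_ge0//.
by apply: eq_bigr => j _; rewrite natrD mulrDl semigroupD// mulr_ge0.
Qed.

Lemma riemannM d N K f : 0 <= d ->
  riemann d (N * K) f = riemann (K%:R * d) N (riemann d K f).
Proof.
move=> d0; elim: N => [|N IH]; first by rewrite /riemann !big_ord0.
rewrite mulSnr riemannD// IH [in RHS]/riemann big_ord_recr/= -/(riemann _ _ _).
by rewrite natrM mulrA.
Qed.

Lemma riemann_dist d n f s c :
  (forall j, (j < n)%N -> sumsn s (T (j%:R * d) f - f) <= c) ->
  sumsn s (riemann d n f - n%:R *.: f) <= n%:R * c.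
Proof.
move=> nc.
have -> : n%:R *.: f = \sum_(j < n) f.
  by rewrite sumr_const card_ord /rscale rmorph_nat scaler_nat.
rewrite /riemann -sumrB (le_trans (sumsn_sum p_gen _ _ _))//.
have -> : n%:R * c = \sum_(j < n) c by rewrite sumr_const card_ord mulr_natl.
by apply: ler_sum => j _; exact: nc.
Qed.

Lemma riemann_le d n f s c :
  (forall j, (j < n)%N -> sumsn s (T (j%:R * d) f) <= c) ->
  sumsn s (riemann d n f) <= n%:R * c.
Proof.
move=> nc; rewrite (le_trans (sumsn_sum p_gen _ _ _))//.
have -> : n%:R * c = \sum_(j < n) c by rewrite sumr_const card_ord mulr_natl.
by apply: ler_sum => j _; exact: nc.
Qed.

Lemma riemannB d n x y : 0 <= d ->
  riemann d n (x - y) = riemann d n x - riemann d n y.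
Proof.
move=> d0; rewrite /riemann -sumrB; apply: eq_bigr => j _.
by rewrite (linearB_of (semigroup_linear _)) ?mulr_ge0.
Qed.

Lemma riemannZ d n a x : 0 <= d -> riemann d n (a *.: x) = a *.: riemann d n x.
Proof.
move=> d0; rewrite /riemann [in RHS]/rscale scaler_sumr; apply: eq_bigr => j _.
by rewrite (linear_rscale (semigroup_linear _)) ?mulr_ge0.
Qed.

(** Riemann sum with [N] nodes for the average of [T u f] over [0 <= u <= a]. *)
Definition mean a N f : X := N%:R^-1 *.: riemann (a / N%:R) N f.

Lemma mean1 a f : mean a 1 f = f.
Proof. by rewrite /mean /riemann big_ord1 mul0r semigroup0 invr1 rscale1. Qed.

(** Grouping the fine nodes by coarse cells writes the difference as an average of translates, by
    [T] at the coarse nodes, of one vector: the average of [T u f - f] over the nodes [u] of the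
    first cell. Passing from [s] to [s'] absorbs the translations. *)
Lemma mean_refine a N K f s s' c : 0 <= a -> (0 < N)%N -> (0 < K)%N ->
  (forall t, 0 <= t <= a -> forall x, sumsn s (T t x) <= sumsn s' x) ->
  (forall t, 0 <= t <= a / N%:R -> sumsn s' (T t f - f) <= c) ->
  sumsn s (mean a (N * K) f - mean a N f) <= c.
Proof.
move=> a0 N0 K0 ss' fc.
have NK0 : (0 < N * K)%N by rewrite muln_gt0 N0.
set d := a / (N * K)%:R.
have d0 : 0 <= d by rewrite divr_ge0.
have Kd : K%:R * d = a / N%:R.
  by rewrite /d natrM; field; rewrite !pnatr_eq0 -!lt0n N0.
have -> : mean a (N * K) f - mean a N f =
    N%:R^-1 *.: riemann (a / N%:R) N (K%:R^-1 *.: (riemann d K f - K%:R *.: f)).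
  rewrite /mean -/d riemannM// Kd rscaleBr rscaleA mulVf ?pnatr_eq0 -?lt0n//.
  rewrite rscale1 riemannB ?divr_ge0// riemannZ ?divr_ge0// rscaleBr rscaleA.
  by rewrite natrM invfM.
rewrite sumsnZ// ger0_norm ?invr_ge0// [_^-1 * _]mulrC ler_pdivrMr ?ltr0n//.
rewrite [c * _]mulrC.
apply: riemann_le => j jN; apply: le_trans (ss' _ _ _) _.
  rewrite mulr_ge0 ?divr_ge0//= mulrA ler_pdivrMr ?ltr0n// mulrC ler_wpM2l//.
  by rewrite ler_nat ltnW.
rewrite sumsnZ// ger0_norm ?invr_ge0// [_^-1 * _]mulrC ler_pdivrMr ?ltr0n//.
rewrite [c * _]mulrC.
apply: riemann_dist => i iK; apply: fc; rewrite mulr_ge0//= -Kd ler_wpM2r//.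
by rewrite ler_nat ltnW.
Qed.

(** Splitting [riemann d (m + N) f] after [m] or after [N] terms gives the discrete form of the
    identity between [T h - I] applied to the integral over [[0, a]] and [T a - I] applied to the
    integral over [[0, h]]. For small [h] the latter integral is close to [h] times [f]. *)
Lemma mean_shift a N m f s s' c : 0 < a -> (0 < N)%N ->
  (forall x, sumsn s (T a x) <= sumsn s' x) ->
  (forall j, (j < m)%N ->
     sumsn (s' ++ s) (T (j%:R * (a / N%:R)) f - f) <= c) ->
  sumsn s (T (m%:R * (a / N%:R)) (mean a N f) - mean a N f
    - (m%:R / N%:R) *.: (T a f - f)) <= m%:R / N%:R * c.
Proof.
move=> a0 N0 ss' fc; set d := a / N%:R.
have d0 : 0 <= d by rewrite divr_ge0// ltW.
have Nd : N%:R * d = a by rewrite /d; field; rewrite pnatr_eq0 -lt0n.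
have md0 : 0 <= m%:R * d by rewrite mulr_ge0.
have -> : T (m%:R * d) (mean a N f) - mean a N f =
    N%:R^-1 *.: (T a (riemann d m f) - riemann d m f).
  rewrite /mean -/d (linear_rscale (semigroup_linear md0)) -rscaleBr.
  congr (_ *.: _); apply/(addIr (riemann d N f + riemann d m f)).
  rewrite [in RHS](addrC (riemann d N f)) !addrA !subrK.
  by rewrite addrC -riemannD// [RHS]addrC -[in RHS]Nd -riemannD// addnC.
have -> : (m%:R / N%:R) *.: (T a f - f) =
    N%:R^-1 *.: (T a (m%:R *.: f) - m%:R *.: f).
  rewrite (linear_rscale (semigroup_linear (ltW a0))) -rscaleBr rscaleA.
  by rewrite mulrC.
rewrite -rscaleBr sumsnZ// ger0_norm ?invr_ge0// mulrAC mulrC.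
rewrite ler_pM2r ?invr_gt0 ?ltr0n//.
apply: le_trans (sumsn_BB _ _ _ _ _) _.
rewrite -(linearB_of (semigroup_linear (ltW a0))).
apply: le_trans (lerD (ss' _) (lexx _)) _.
by rewrite -sumsn_cat; exact: riemann_dist.
Qed.

End Semigroup.

Arguments mean {R k X} T a N f.

(** * Density of the domain of the generator *)

Section GeneratorDense.
Context {R : realType} {k : scalars} {X : tvsType (scalar_field R k)}.
Context {Omega : Type} {p : Omega -> X -> R}.
Context (p_gen : generated_by p) (X_complete : sequentially_complete X).
Context {T : R -> X -> X} (T_semigroup : lC0_semigroup p T).
Implicit Types (x y z f : X) (a b c e h t S : R) (s : seq Omega).
Implicit Types (n m K N : nat).
Local Notation "a *.: x" := (rscale a x) (at level 40).
Local Notation sumsn := (sumsn (p := p)).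

Lemma div2n_small a e : 0 < e -> exists n0, forall n, (n0 <= n)%N ->
  a / (2 ^ n)%:R < e.
Proof.
move=> e0; exists (Num.truncn (a / e)).+1 => n nn.
rewrite ltr_pdivrMr ?ltr0n ?expn_gt0// mulrC -ltr_pdivrMr//.
apply: lt_le_trans (truncnS_gt _) _; rewrite ler_nat.
by rewrite (leq_trans nn)// ltnW// ltn_expl.
Qed.

(** Powers of two divide one another, so each later mean refines the one of index [n0], and
    [mean_refine] compares them without summing over intermediate levels. *)
Lemma mean_cauchy a f : 0 < a -> cauchy (mean T a (2 ^ n) f @[n --> \oo]).
Proof.
move=> a0 E /(entourage_sumsn p_gen)[s [e [e0 sE]]].
have [s' s'P] := semigroup_sumsn p_gen T_semigroup s (ltW a0).
have e20 : 0 < e / 3 by rewrite divr_gt0.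
have [d [d0 dP]] := semigroup_continuous0 p_gen T_semigroup f s' e20.
have [n0 n0P] := div2n_small a d0.
pose u n := mean T a (2 ^ n) f.
have close n : (n0 <= n)%N -> sumsn s (u n - u n0) <= e / 3.
  move=> n0n; rewrite /u -(subnKC n0n) expnD.
  apply: (mean_refine p_gen T_semigroup (ltW a0) _ _ s'P); rewrite ?expn_gt0//.
  move=> t /andP[t0 ta]; apply/ltW/dP; rewrite t0/=.
  by apply: le_lt_trans ta _; exact: n0P.
pose A := [set x | sumsn s (x - u n0) <= e / 3].
exists (A, A).
  by split; exists n0 => // n /= n0n; exact: close.
move=> [x y] [/= Ax Ay]; apply: sE => /=.
apply: le_lt_trans (sumsn_dist p_gen _ _ (u n0) _) _.
by rewrite [sumsn s (u n0 - y)](sumsnC p_gen); move: Ax Ay; rewrite /A/=; lra.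
Qed.

(** The vector [y] stands for the average of [T u f] over [[0, a]]; [mean_shift] is carried over to
    it by letting the mesh tend to zero while [h] stays fixed. *)
Lemma mean_limit_quotient a f y : 0 < a ->
  mean T a (2 ^ n) f @[n --> \oo] --> y ->
  of_real k h^-1 *: (T h y - y) @[h --> 0^'+] --> a^-1 *.: (T a f - f).
Proof.
move=> a0 uy; apply/(cvg_at_right0_sumsn p_gen) => s e e0.
have [s' s'P] := semigroup_sumsn p_gen T_semigroup s (ltW a0).
have c0 : 0 < e * a / 2 by rewrite divr_gt0// mulr_gt0.
have [d [d0 dP]] := semigroup_continuous0 p_gen T_semigroup f (s' ++ s) c0.
set c := e * a / 2 in c0 dP.
exists d; split=> // h /andP[h0 hd].
(* After division by [h] this leaves [c / a], which is [e / 2] by the choice of [c]. *)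
suff main : sumsn s (T h y - y - (h / a) *.: (T a f - f)) <= h / a * c.
  have -> : of_real k h^-1 *: (T h y - y) - a^-1 *.: (T a f - f) =
      h^-1 *.: (T h y - y - (h / a) *.: (T a f - f)).
    by rewrite [RHS]rscaleBr rscaleA mulrA mulVf ?gt_eqF// mul1r.
  rewrite sumsnZ// ger0_norm ?invr_ge0 ?(ltW h0)// mulrC ltr_pdivrMr//.
  apply: le_lt_trans main _; rewrite /c.
  have -> : h / a * (e * a / 2) = e * h / 2 by field; rewrite gt_eqF.
  by have := mulr_gt0 e0 h0; lra.
(* The slack [r] appears once [h] is fixed, so the mesh may depend on [h]. It pays for replacing [y]
   by a mean and [h] by a multiple of the mesh. *)
apply/ler_addgt0Pr => r r0.
have [s3 s3P] := semigroup_sumsn p_gen T_semigroup s (ltW h0).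
have r40 : 0 < r / 4 by rewrite divr_gt0.
have [d3 [d30 d3P]] := semigroup_continuous0 p_gen T_semigroup y s3 r40.
have w0 : 0 <= sumsn s (T a f - f) by exact: sumsn_ge0.
set w := T a f - f in w0 *.
have r4w : 0 < r / 4 * a / (sumsn s w + 1).
  by apply: divr_gt0; [exact: mulr_gt0 | rewrite ltr_wpDl].
have [n1 n1P] := div2n_small a d30.
have [n2 n2P] := div2n_small a r4w.
have [n3 _ n3P] := (cvg_sumsn p_gen _ _ _).1 uy (s3 ++ s) _ r40.
set n := maxn n1 (maxn n2 n3).
have {n1P} N1 : a / (2 ^ n)%:R < d3 by apply: n1P; rewrite leq_max leqnn.
have {n2P} N2 : a / (2 ^ n)%:R < r / 4 * a / (sumsn s w + 1).
  by apply: n2P; rewrite !leq_max leqnn orbT.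
have {n3P} N3 : sumsn (s3 ++ s) (mean T a (2 ^ n) f - y) < r / 4.
  by apply: n3P; rewrite /= !leq_max leqnn !orbT.
have N0 : (0 < 2 ^ n)%N by rewrite expn_gt0.
move: (2 ^ n)%N N0 N1 N2 N3 => {n uy n1 n2 n3} N N0 N1 N2 N3.
set sg := a / N%:R in N1 N2.
have sg0 : 0 < sg by rewrite divr_gt0// ltr0n.
set m := Num.truncn (h / sg).
have /andP[m1 m2] : (m%:R <= h / sg < m.+1%:R).
  by rewrite truncn_itv// divr_ge0// ltW.
rewrite ler_pdivlMr// in m1; rewrite ltr_pdivrMr// -natr1 mulrDl mul1r in m2.
have msg0 : 0 <= m%:R * sg by rewrite mulr_ge0// ltW.
have S : sumsn s (T (m%:R * sg) (mean T a N f) - mean T a N f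
    - (m%:R / N%:R) *.: w) <= m%:R / N%:R * c.
  apply: (mean_shift p_gen T_semigroup a0 N0 (s' := s')).
    by move=> x; apply: s'P; rewrite lexx ltW.
  move=> j jm; apply/ltW/dP; rewrite mulr_ge0 ?(ltW sg0)//=.
  apply: le_lt_trans hd; apply: le_trans m1; rewrite ler_wpM2r ?(ltW sg0)//.
  by rewrite ler_nat ltnW.
have mN : m%:R / N%:R = m%:R * sg / a.
  by rewrite /sg; field; rewrite gt_eqF//= pnatr_eq0 -lt0n.
rewrite mN in S.
rewrite sumsn_cat in N3.
apply: le_trans (sumsn_dist p_gen _ _
  (T (m%:R * sg) (mean T a N f) - mean T a N f) _) _.
have E1 : sumsn s (T h y - y - (T (m%:R * sg) (mean T a N f) - mean T a N f))
    <= r / 2.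
  apply: le_trans (sumsn_BB p_gen _ _ _ _ _) _.
  have := sumsn_dist p_gen s (T h y) (T (m%:R * sg) y)
    (T (m%:R * sg) (mean T a N f)).
  rewrite -[in T h y](subrKC (m%:R * sg) h).
  rewrite (semigroupD T_semigroup) ?subr_ge0//.
  rewrite -!(linearB_of (semigroup_linear T_semigroup msg0)).
  have B1 := s3P (m%:R * sg) _ (T (h - m%:R * sg) y - y).
  have B2 := s3P (m%:R * sg) _ (y - mean T a N f).
  have D3 : sumsn s3 (T (h - m%:R * sg) y - y) < r / 4.
    by apply: d3P; rewrite subr_ge0 m1/= (lt_trans _ N1)// ltrBlDl.
  rewrite msg0 m1 in B1 B2; move: {B1} (B1 isT) {B2} (B2 isT).
  rewrite (sumsnC p_gen s3 y) (sumsnC p_gen s y).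
  by move: N3 D3; lra.
(* The coefficient of [w] changes by at most [sg / a] when [m * sg] becomes [h]; [N2] bounds this
   cost by [r / 4]. *)
have E2 : sumsn s (T (m%:R * sg) (mean T a N f) - mean T a N f - (h / a) *.: w)
    <= h / a * c + r / 4.
  apply: le_trans (sumsn_dist p_gen _ _ ((m%:R * sg / a) *.: w) _) _.
  apply: lerD.
    apply: le_trans S _; rewrite ler_wpM2r ?(ltW c0)// ler_wpM2r//.
    by rewrite invr_ge0 ltW.
  rewrite -rscaleBl sumsnZ// -mulrBl normrM.
  rewrite [`|a^-1|]ger0_norm ?invr_ge0 ?(ltW a0)//.
  rewrite distrC ger0_norm ?subr_ge0//.
  rewrite mulrAC ler_pdivrMr// (@le_trans _ _ (sg * (sumsn s w + 1)))//.
    apply: ler_pM => //; [by rewrite subr_ge0 | | by rewrite lerDl].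
    by rewrite lerBlDl ltW.
  by rewrite -ler_pdivlMr ?ltr_wpDl// ltW.
by lra.
Qed.

(** The average of the orbit of [f] over [[0, a]] has a derivative at zero, and it is close to [f]
    when [a] is small. *)
Lemma generator_dense f s e : 0 < e -> exists y,
  (exists g : X, of_real k h^-1 *: (T h y - y) @[h --> 0^'+] --> g) /\
  sumsn s (y - f) < e.
Proof.
move=> e0.
have [s' s'P] := semigroup_sumsn p_gen T_semigroup s ler01.
have e20 : 0 < e / 3 by rewrite divr_gt0.
have [d [d0 dP]] := semigroup_continuous0 p_gen T_semigroup f s' e20.
pose a := Num.min 1 (d / 2).
have a0 : 0 < a by rewrite lt_min ltr01 divr_gt0.
have ad : a < d by rewrite gt_min; apply/orP; right; lra.
have a1 : a <= 1 by rewrite ge_min lexx.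
have [y uy] := X_complete (mean_cauchy f a0).
exists y; split.
  by exists (a^-1 *.: (T a f - f)); exact: mean_limit_quotient.
have [n _ nP] := (cvg_sumsn p_gen _ _ _).1 uy s _ e20.
apply: le_lt_trans (sumsn_dist p_gen _ _ (mean T a (2 ^ n) f) _) _.
rewrite (sumsnC p_gen s y).
have := nP n (leqnn n) => /=.
suff : sumsn s (mean T a (2 ^ n) f - f) <= e / 3 by lra.
(* Seen as the mean with a single node, [f] is compared with its dyadic refinements. *)
rewrite -{2}(mean1 T_semigroup a f) -(mul1n (2 ^ n)%N).
apply: (mean_refine p_gen T_semigroup (ltW a0) _ _ (s' := s')).
- by [].
- by rewrite expn_gt0.
- by move=> t /andP[t0 ta] x; apply: s'P; rewrite t0 (le_trans ta).
move=> t; rewrite divr1 => /andP[t0 ta]; apply/ltW/dP.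
by rewrite t0 (le_lt_trans ta).
Qed.

End GeneratorDense.

(** * One step of [F h] along a polygonal path *)

Section Approximation.
Context {R : realType} {k : scalars} {X : tvsType (scalar_field R k)}.
Context {Omega : Type} {p : Omega -> X -> R}.
Context (p_gen : generated_by p).
Implicit Types (x y z f : X) (a b c e h t S : R) (s : seq Omega).
Implicit Types (n m K N : nat).
Local Notation "a *.: x" := (rscale a x) (at level 40).
Local Notation sumsn := (sumsn (p := p)).

(** Polygonal path through the vertices [w i], with [L] steps on each edge. *)
Definition interpolate (w : nat -> X) (L j : nat) : X :=
  w (j %/ L)%N + ((j %% L)%:R / L%:R) *.: (w (j %/ L).+1 - w (j %/ L)%N).

Lemma interpolateS w L j : (0 < L)%N ->
  interpolate w L j.+1 =
  interpolate w L j + L%:R^-1 *.: (w (j %/ L).+1 - w (j %/ L)%N).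
Proof.
move=> L0; rewrite /interpolate; set i := (j %/ L)%N; set l := (j %% L)%N.
have jE : j = (i * L + l)%N by exact: divn_eq.
have : (l < L)%N by exact: ltn_pmod.
have L_neq0 : L%:R != 0 :> R by rewrite pnatr_eq0 -lt0n.
(* On the last step of an edge the quotient increases and the remainder returns to zero: the path
   lands on the next vertex. *)
rewrite leq_eqVlt => /orP[/eqP lL|lL].
  have -> : j.+1 = (i.+1 * L + 0)%N by rewrite jE -addnS lL addn0 mulSn addnC.
  rewrite divnMDl// modnMDl div0n mod0n !addn0 mul0r rscale0 addr0.
  rewrite -addrA -rscaleDl.
  have -> : l%:R / L%:R + L%:R^-1 = 1 :> R.
    by rewrite -[X in _ + X]mul1r -mulrDl natr1 lL divff.
  by rewrite rscale1 subrKC.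
have -> : j.+1 = (i * L + l.+1)%N by rewrite jE -addnS.
rewrite divnMDl// modnMDl divn_small// modn_small// addn0.
by rewrite -addrA -rscaleDl -natr1 mulrDl mul1r.
Qed.

(** In the application [x], [x'] are the values of [T] on [g], and [y], [y'] those on [Z g], at two
    neighbouring mesh points. Both [G v - v] and the increment of the path are compared with
    [h *.: y], at costs [4 * r * h] and [8 * r * h]. *)
Lemma interpolate_step s (G : X -> X) (w w' x x' y y' : X) (L h d r u : R) :
  linear G -> 0 < h -> 0 < d -> 0 <= r -> 0 <= u <= 1 ->
  L * h <= d -> d <= L * h + h -> d <= 2 * (L * h) ->
  sumsn s (w - x) <= r * d -> sumsn s (w' - x') <= r * d ->
  sumsn s (G w - w - h *.: y) <= r * h ->
  sumsn s (G w' - w' - h *.: y') <= r * h ->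
  sumsn s (y' - y) <= r -> sumsn s (x' - x - d *.: y) <= r * d ->
  h * sumsn s y <= r * d ->
  sumsn s (G (w + u *.: (w' - w)) - (w + u *.: (w' - w) + L^-1 *.: (w' - w)))
    <= 12 * r * h.
Proof.
move=> linG h0 d0 r0 /andP[u0 u1] Lh1 Lh2 Lh3 wx wx' Gw Gw' yy' xx' hy.
have L0 : 0 < L by rewrite -(pmulr_lgt0 _ h0); lra.
rewrite opprD addrA.
apply: le_trans (sumsn_dist p_gen _ _ (h *.: y) _) _.
have E1 : sumsn s (G (w + u *.: (w' - w)) - (w + u *.: (w' - w)) - h *.: y)
    <= 4 * r * h.
  have -> : G (w + u *.: (w' - w)) - (w + u *.: (w' - w)) - h *.: y =
      (G w - w - h *.: y) + u *.: ((G w' - w') - (G w - w)).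
    rewrite linearD_of// linear_rscale// linearB_of// opprD addrACA -rscaleBr.
    by rewrite subrACA [LHS]addrAC.
  apply: le_trans (sumsnD p_gen _ _ _) _.
  rewrite sumsnZ// ger0_norm//.
  have B : sumsn s ((G w' - w') - (G w - w)) <= 3 * r * h.
    apply: le_trans (sumsn_dist p_gen _ _ (h *.: y') _) _.
    have := sumsn_dist p_gen s (h *.: y') (h *.: y) (G w - w).
    rewrite -rscaleBr sumsnZ// gtr0_norm// [X in _ <= _ + X -> _](sumsnC p_gen).
    have : h * sumsn s (y' - y) <= h * r by rewrite ler_pM2l.
    by move: Gw Gw'; lra.
  have := @ler_pM _ u 1 _ _ u0 (sumsn_ge0 p_gen s _) u1 B.
  by move: Gw; lra.
(* The vertices are only known up to [r * d], but the increment is an edge divided by [L], and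
   [d <= 2 * (L * h)] turns [4 * r * d] into [8 * r * h]. *)
have E2 : sumsn s (h *.: y - L^-1 *.: (w' - w)) <= 8 * r * h.
  have -> : h *.: y - L^-1 *.: (w' - w) = L^-1 *.: ((L * h) *.: y - (w' - w)).
    by rewrite [RHS]rscaleBr rscaleA mulrA mulVf ?gt_eqF// mul1r.
  rewrite sumsnZ// ger0_norm ?invr_ge0 ?(ltW L0)// mulrC ler_pdivrMr//.
  apply: (@le_trans _ _ (4 * r * d)); last first.
    have : r * d <= r * (2 * (L * h)) by rewrite ler_wpM2l.
    by lra.
  apply: le_trans (sumsn_dist p_gen _ _ (d *.: y) _) _.
  have A1 : sumsn s ((L * h) *.: y - d *.: y) <= r * d.
    rewrite -rscaleBl sumsnZ// distrC ger0_norm ?subr_ge0// (le_trans _ hy)//.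
    by rewrite ler_wpM2r ?sumsn_ge0// lerBlDl.
  have A2 : sumsn s (d *.: y - (w' - w)) <= 3 * r * d.
    apply: le_trans (sumsn_dist p_gen _ _ (x' - x) _) _.
    have := sumsn_BB p_gen s x' x w' w.
    rewrite (sumsnC p_gen s x') (sumsnC p_gen s x) (sumsnC p_gen s (d *.: y)).
    by move: wx wx' xx'; lra.
  by move: A1 A2; lra.
by move: E1 E2; lra.
Qed.

Lemma finite_small (P : nat -> R -> Prop) K :
  (forall i, (i <= K)%N ->
     exists d : R, 0 < d /\ forall h, 0 < h < d -> P i h) ->
  exists d : R, 0 < d /\
    forall h, 0 < h < d -> forall i, (i <= K)%N -> P i h.
Proof.
elim: K => [|K IH] KP.
  have [d [d0 dP]] := KP 0%N isT; exists d; split=> // h hd i.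
  by rewrite leqn0 => /eqP ->; exact: dP.
have [d [d0 dP]] := IH (fun i iK => KP i (leqW iK)).
have [d' [d'0 d'P]] := KP K.+1 (leqnn _).
exists (Num.min d d'); split=> [|h]; first by rewrite lt_min d0.
rewrite lt_min => /and3P[h0 hd hd'] i; rewrite leq_eqVlt => /orP[/eqP ->|].
  by apply: d'P; rewrite h0.
by rewrite ltnS; apply: dP; rewrite h0.
Qed.

End Approximation.

(** * Consistency of [F] with the generator and the error on a fixed mesh *)

Section Chernoff.
Context {R : realType} {k : scalars} {X : tvsType (scalar_field R k)}.
Context {Omega : Type} {p : Omega -> X -> R}.
Context (p_gen : generated_by p) (X_hausdorff : hausdorff_space X).
Context {Z : operator X} {T : R -> X -> X}.
Context (T_semigroup : lC0_semigroup p T) (Z_gen : is_generator T Z).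
Implicit Types (x y z f g : X) (a b c e h t S : R) (s : seq Omega).
Implicit Types (n m K N : nat).
Local Notation "a *.: x" := (rscale a x) (at level 40).
Local Notation sumsn := (sumsn (p := p)).

(** The difference quotient at [T t x] is [T t] applied to the one at [x]; separation of [X]
    identifies the limit. *)
Lemma generator_comm x t : op_dom Z x -> 0 <= t ->
  op_dom Z (T t x) /\ Z (T t x) = T t (Z x).
Proof.
move=> Zx t0.
suff H : of_real k h^-1 *: (T h (T t x) - T t x) @[h --> 0^'+] --> T t (Z x).
  have Ztx : op_dom Z (T t x) by rewrite Z_gen.1; exists (T t (Z x)).
  by split=> //; exact: (cvg_unique X_hausdorff (Z_gen.2 _ Ztx) H).
apply/(cvg_at_right0_sumsn p_gen) => s e e0.
have [s' s'P] := semigroup_sumsn p_gen T_semigroup s t0.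
have [d [d0 dP]] := (cvg_at_right0_sumsn p_gen _ _).1 (Z_gen.2 _ Zx) s' e e0.
exists d; split=> // h /andP[h0 hd].
have linT := semigroup_linear T_semigroup t0.
rewrite -(semigroupD T_semigroup _ (ltW h0) t0) [h + t]addrC.
rewrite (semigroupD T_semigroup _ t0 (ltW h0)) -(linearB_of linT).
rewrite -/(h^-1 *.: _) -(linear_rscale linT) -(linearB_of linT).
apply: le_lt_trans (s'P _ _ _) _; first by rewrite t0 lexx.
by apply: dP; rewrite h0.
Qed.

(** The core supplies [f] in [D] with [(f, Z f)] close to [(x, Z x)], and [w] is the member at [h]
    of a family witnessing [mef F f (Z f)]. *)
Lemma core_consistent (D : set X) (F : R -> X -> X) : is_core Z D -> F 0 = id ->
  (forall f, D f -> mef F f (Z f)) ->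
  forall x s e, op_dom Z x -> 0 < e -> exists d : R, 0 < d /\
    forall h, 0 < h < d -> exists w,
      sumsn s (w - x) <= e /\ sumsn s (F h w - w - h *.: Z x) <= e * h.
Proof.
move=> [_ coreE] F0 FZ x s e Zx e0.
have e20 : 0 < e / 2 by rewrite divr_gt0.
have : closure (graph Z D) (x, Z x) by rewrite coreE; exists x.
pose U z := [set y | sumsn s (y - z) < e / 2].
have nU z : nbhs z (U z) by apply/(nbhs_sumsn p_gen); exists s, (e / 2); split.
move=> /(_ (U x `*` U (Z x))) [|_ [[f Df <-] [/= fx Zfx]]].
  by exists (U x, U (Z x)).
have [u [uf Fu]] := FZ f Df.
have [d1 [d10 d1P]] := (cvg_at_right0_sumsn p_gen _ _).1 uf s _ e20.
have [d2 [d20 d2P]] := (cvg_at_right0_sumsn p_gen _ _).1 Fu s _ e20.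
exists (Num.min d1 d2); split=> [|h]; first by rewrite lt_min d10.
rewrite lt_min => /and3P[h0 hd1 hd2]; exists (u h); split.
  have := sumsn_dist p_gen s (u h) f x.
  by have := d1P h; rewrite h0 => /(_ hd1); move: fx; rewrite /U/=; lra.
have := d2P h; rewrite h0 => /(_ hd2).
have := sumsn_dist p_gen s (of_real k h^-1 *: (F h (u h) - F 0 (u h)))
  (Z f) (Z x).
have -> : F h (u h) - u h - h *.: Z x =
    h *.: (of_real k h^-1 *: (F h (u h) - F 0 (u h)) - Z x).
  by rewrite F0 [RHS]rscaleBr rscaleA mulfV ?gt_eqF// rscale1.
rewrite sumsnZ// gtr0_norm// [e * h]mulrC ler_pM2l//.
by move: Zfx; rewrite /U/=; lra.
Qed.

(** For [b <= a], [T a f - T b f] is [T b] applied to [T (a - b) f - f], so continuity at zero gives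
    a uniform modulus. *)
Lemma semigroup_modulus S s s' f d r : 0 <= S ->
  (forall t, 0 <= t <= S -> forall x, sumsn s (T t x) <= sumsn s' x) ->
  (forall t, 0 <= t <= d -> sumsn s' (T t f - f) <= r) ->
  forall a b, 0 <= a <= S -> 0 <= b <= S -> `|a - b| <= d ->
    sumsn s (T a f - T b f) <= r.
Proof.
move=> S0 sP fr a b.
wlog ab : a b / b <= a.
  move=> H aS bS abd; have [ba|/ltW ab] := leP b a; first exact: H.
  by rewrite (sumsnC p_gen) H// distrC.
move=> aS bS; rewrite ger0_norm ?subr_ge0// => abd.
have b0 : 0 <= b by case/andP: bS.
rewrite -[in T a f](subrKC b a) (semigroupD T_semigroup) ?subr_ge0//.
rewrite -(linearB_of (semigroup_linear T_semigroup b0)).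
by apply: le_trans (sP _ bS _) _; apply: fr; rewrite subr_ge0 ab.
Qed.

(* The mesh size [d] serves all [n] and [t]; the step [h = t / n] need not
   divide it, so [d] is rounded down to [L * h] and [L] steps are identified
   with one mesh interval.  The resulting drift of the time is at most [d]. *)
Lemma chernoff_estimate (F : R -> X -> X) (g z : X) (t0 : R) s s1 s2 (r d : R) M
    (w : nat -> X) n t :
  0 < t0 -> 0 < r -> 0 < d -> d <= 1 -> M%:R * d = t0 -> (0 < M)%N ->
  (forall t, 0 <= t -> linear (F t)) ->
  (forall n m t, (0 < n)%N -> (m <= n)%N -> 0 <= t <= t0 ->
    forall x, sumsn s (iter m (F (t / n%:R)) x) <= sumsn s1 x) ->
  (forall t, 0 <= t <= 3 * t0 ->
    forall x, sumsn (s ++ s1) (T t x) <= sumsn s2 x) ->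
  (forall t, 0 <= t <= d -> sumsn s2 (T t g - g) <= r) ->
  (forall t, 0 <= t <= d -> sumsn s2 (T t z - z) <= r) ->
  sumsn s2 (T d g - g - d *.: z) <= r * d ->
  (0 < n)%N -> 0 < t <= t0 ->
  t / n%:R * (2 * M.+1%:R) <= d -> t / n%:R * sumsn s2 z <= r * d ->
  (forall i, (i <= M.*2.+1)%N ->
    sumsn (s ++ s1) (w i - T (i%:R * d) g) <= r * d /\
    sumsn (s ++ s1) (F (t / n%:R) (w i) - w i
      - (t / n%:R) *.: T (i%:R * d) z) <= r * (t / n%:R)) ->
  sumsn s (iter n (F (t / n%:R)) g - T t g) <= (12 * t0 + 6) * r.
Proof.
move=> t00 r0 d0 d1 Md M0 linF FP TP gr Zgr Tdg n0 /andP[t_gt0 tt0].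
set h := t / n%:R => hM hZ wP.
have h0 : 0 < h by rewrite divr_gt0// ltr0n.
have nh : n%:R * h = t by rewrite /h; field; rewrite pnatr_eq0 -lt0n.
have M1 : 1 <= M%:R :> R by rewrite ler1n.
have hM' : 2 * (h * M%:R) + 2 * h <= d by move: hM; rewrite -natr1; lra.
have hhM : h <= h * M%:R by rewrite -{1}[h]mulr1 ler_pM2l.
pose L := Num.truncn (d / h).
have /andP[L1 L2] : (L%:R <= d / h < L.+1%:R).
  by rewrite truncn_itv// divr_ge0// ltW.
rewrite ler_pdivlMr// in L1; rewrite ltr_pdivrMr// -natr1 mulrDl mul1r in L2.
have L0 : (0 < L)%N by rewrite truncn_gt0 ler_pdivlMr// mul1r; lra.
have iT i : (i <= M.*2.+1)%N -> 0 <= i%:R * d <= 3 * t0.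
  move=> iM; rewrite mulr_ge0 ?(ltW d0)//= -Md mulrA ler_pM2r//.
  have : i%:R <= M.*2.+1%:R :> R by rewrite ler_nat.
  by rewrite -natr1 -mul2n natrM; lra.
(* Rounding keeps [L * h] above [d / 2], so [n] steps use at most twice the [M] mesh intervals. The
   right end of the last edge has index at most [M.*2.+1], hence time at most [3 * t0]. *)
have jM j : (j <= n)%N -> (j %/ L <= M.*2)%N.
  move=> jn; have : ((j %/ L) * L <= n)%N.
    exact: leq_trans (leq_trunc_div _ _) jn.
  rewrite -(ler_nat R) natrM -(ler_pM2r h0) nh -mulrA => jLt.
  have : (j %/ L)%:R * (d / 2) <= M%:R * d.
    rewrite Md (le_trans _ (le_trans jLt tt0))// ler_wpM2l//; lra.
  have -> : M%:R * d = M.*2%:R * (d / 2) by rewrite -mul2n natrM; field.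
  by rewrite ler_pM2r ?divr_gt0// ler_nat.
have sA x : sumsn s x <= sumsn (s ++ s1) x by rewrite sumsn_cat lerDl sumsn_ge0.
have s1A x : sumsn s1 x <= sumsn (s ++ s1) x.
  by rewrite sumsn_cat lerDr sumsn_ge0.
have rd : r * d <= r by rewrite -[X in _ <= X]mulr1 ler_pM2l.
have t30 : 0 <= 3 * t0 by lra.
have modG := semigroup_modulus t30 TP gr.
have succ i : `|i.+1%:R * d - i%:R * d| <= d.
  by rewrite -natr1 mulrDl mul1r addrAC subrr add0r gtr0_norm.
pose v j := interpolate w L j.
have theta j : 0 <= ((j %% L)%:R / L%:R : R) <= 1.
  apply/andP; split; first exact: divr_ge0.
    by rewrite ler_pdivrMr ?ltr0n// mul1r ler_nat ltnW// ltn_pmod.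
have step j : (j < n)%N -> sumsn s1 (F h (v j) - v j.+1) <= 12 * r * h.
  move=> jn; have iM := jM j (ltnW jn); set i := (j %/ L)%N in iM.
  apply: le_trans (s1A _) _; rewrite /v interpolateS// -/i.
  have [w1 w2] := wP i (leqW iM).
  have [w1' w2'] := wP i.+1 iM.
  have i0 := iT _ (leqW iM); have i0' := iT i.+1 iM.
  have /andP[id0 _] := i0.
  apply: (interpolate_step p_gen (d := d) _ h0 d0 (ltW r0) (theta j) _ _ _
    w1 w1' w2 w2').
  - exact: linF (ltW h0).
  - exact: L1.
  - exact: ltW.
  - lra.
  - by apply: (semigroup_modulus t30 TP Zgr) => //; exact: succ.
  - rewrite -natr1 mulrDl mul1r (semigroupD T_semigroup _ id0 (ltW d0)).
    have linT := semigroup_linear T_semigroup id0.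
    rewrite -(linear_rscale linT) -!(linearB_of linT).
    exact: le_trans (TP _ i0 _) Tdg.
  - by apply: le_trans hZ; rewrite ler_pM2l// TP.
have [w01 _] := wP 0%N isT.
rewrite mul0r (semigroup0 T_semigroup) in w01.
have E0 : sumsn s (iter n (F h) g - iter n (F h) (v 0%N)) <= r.
  rewrite -(linearB_of (linear_iter (linF _ (ltW h0)) n)).
  apply: le_trans (FP _ _ _ n0 (leqnn n) _ _) _; first by rewrite (ltW t_gt0).
  rewrite (sumsnC p_gen) /v /interpolate div0n mod0n mul0r rscale0 addr0.
  by apply: le_trans (s1A _) _; exact: le_trans w01 rd.
(* There are [n] errors of size [12 * r * h], and [n * h = t <= t0]. *)
have E1 : sumsn s (iter n (F h) (v 0%N) - v n) <= 12 * t0 * r.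
  have bound m x : (m <= n)%N -> sumsn s (iter m (F h) x) <= sumsn s1 x.
    by move=> mn; apply: FP => //; rewrite (ltW t_gt0).
  apply: le_trans (iter_telescope p_gen v (linF _ (ltW h0)) bound) _.
  apply: (@le_trans _ _ (\sum_(j < n) 12 * r * h)).
    by apply: ler_sum => j _; exact: step.
  rewrite sumr_const card_ord -[_ *+ _]mulr_natl.
  have : t * r <= t0 * r by rewrite ler_pM2r.
  by rewrite -nh; lra.
have iM := jM n (leqnn n).
have E2 : sumsn s (v n - T ((n %/ L)%:R * d) g) <= 4 * r.
  apply: le_trans (sA _) _; rewrite /v /interpolate.
  set i := (n %/ L)%N in iM *.
  have [w1 _] := wP i (leqW iM).
  have [w1' _] := wP i.+1 iM.
  have x' := modG _ _ (iT i.+1 iM) (iT i (leqW iM)) (succ i).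
  rewrite addrAC; apply: le_trans (sumsnD p_gen _ _ _) _.
  have /andP[u0 u1] := theta n.
  rewrite sumsnZ// ger0_norm//.
  have B : sumsn (s ++ s1) (w i.+1 - w i) <= 3 * r.
    have := sumsn_dist p_gen (s ++ s1) (w i.+1) (T (i.+1%:R * d) g) (w i).
    have := sumsn_dist p_gen (s ++ s1) (T (i.+1%:R * d) g) (T (i%:R * d) g)
      (w i).
    by rewrite [sumsn _ (T (i%:R * d) g - w i)](sumsnC p_gen); lra.
  have := @ler_pM _ _ 1 _ _ u0 (sumsn_ge0 p_gen (s ++ s1) _) u1 B.
  by lra.
(* Rounding loses at most [h] per mesh interval, in all at most [2 * M * h <= d]; the unfinished
   edge adds at most [d]. The two deviations have opposite signs, so the times differ by at most
   [d]. *)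
have E3 : sumsn s (T ((n %/ L)%:R * d) g - T t g) <= r.
  apply: le_trans (sA _) _; apply: modG.
  - exact: iT (leqW iM).
  - by rewrite (ltW t_gt0)/=; lra.
  rewrite -nh ler_distl.
  have := divn_eq n L; have := ltn_pmod n L0.
  move: (n %/ L)%N (n %% L)%N iM => i l iM lL nE.
  have -> : n%:R * h = i%:R * (L%:R * h) + l%:R * h.
    by rewrite {1}nE natrD natrM; ring.
  have l0 : 0 <= l%:R * h by rewrite mulr_ge0// ltW.
  have l1 : l%:R * h <= L%:R * h by rewrite ler_pM2r// ler_nat ltnW.
  have i1 : i%:R * (L%:R * h) <= i%:R * d by rewrite ler_wpM2l.
  have i2 : i%:R * d <= i%:R * (L%:R * h + h) by rewrite ler_wpM2l// ltW.
  have i3 : i%:R * h <= M.*2%:R * h by rewrite ler_pM2r// ler_nat.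
  rewrite -mul2n natrM in i3.
  by apply/andP; split; lra.
have := sumsn_dist p_gen s (iter n (F h) g) (iter n (F h) (v 0%N)) (T t g).
have := sumsn_dist p_gen s (iter n (F h) (v 0%N)) (v n) (T t g).
have := sumsn_dist p_gen s (v n) (T ((n %/ L)%:R * d) g) (T t g).
by lra.
Qed.

End Chernoff.

(** * Convergence on the domain of [Z], then on all of [X] *)

Section Convergence.
Context {R : realType} {k : scalars} {X : tvsType (scalar_field R k)}.
Context {Omega : Type} {p : Omega -> X -> R}.
Context (p_gen : generated_by p) (X_hausdorff : hausdorff_space X).
Context {Z : operator X} {T : R -> X -> X}.
Context (T_semigroup : lC0_semigroup p T) (Z_gen : is_generator T Z).
Context {F : R -> X -> X} {D : set X} (F_calE : calE p F).
Context (D_core : is_core Z D).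
Context (F_mef : forall f, D f -> mef F f (Z f)).
Implicit Types (f g : X) (e t : R) (s : seq Omega) (n : nat).
Local Notation "a *.: x" := (rscale a x) (at level 40).
Local Notation sumsn := (sumsn (p := p)).

(** The order of choices matters: first [r], then the seminorms [s1] and [s2], then the mesh [d],
    and only then the threshold [h0] for [t / n]. *)
Lemma chernoff_on_domain (t0 : R) g s e : 0 < t0 -> op_dom Z g -> 0 < e ->
  exists N, forall n, (N <= n)%N -> forall t, 0 <= t <= t0 ->
    sumsn s (iter n (F (t / n%:R)) g - T t g) < e.
Proof.
move=> t00 Zg e0; have [_ F0 _] := F_calE.
have c0 : 0 < 12 * t0 + 6 by lra.
pose r := e / 2 / (12 * t0 + 6).
have r0 : 0 < r by rewrite divr_gt0// divr_gt0.
have [s1 FP] := calE_sumsn p_gen s F_calE (ltW t00).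
have t30 : 0 <= 3 * t0 by lra.
have [s2 TP] := semigroup_sumsn p_gen T_semigroup (s ++ s1) t30.
have [d1 [d10 d1P]] := semigroup_continuous0 p_gen T_semigroup g s2 r0.
have [d2 [d20 d2P]] := semigroup_continuous0 p_gen T_semigroup (Z g) s2 r0.
have [d3 [d30 d3P]] :=
  (cvg_at_right0_sumsn p_gen _ _).1 (Z_gen.2 _ Zg) s2 r r0.
pose d' : R := Num.min (Num.min 1 d1) (Num.min d2 d3).
have d'0 : 0 < d' by rewrite !lt_min ltr01 d10 d20 d30.
(* Taking [d] of the form [t0 / M] below [d'] makes the mesh divide [t0] exactly. *)
pose M := (Num.truncn (t0 / d')).+1; pose d := t0 / M%:R.
have d0 : 0 < d by rewrite divr_gt0.
have : d < d' by rewrite ltr_pdivrMr// mulrC -ltr_pdivrMr// truncnS_gt.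
rewrite !lt_min => /andP[/andP[d_1 d_d1] /andP[d_d2 d_d3]].
have Md : M%:R * d = t0 by rewrite /d mulrC divfK// pnatr_eq0.
have rd0 : 0 < r * d by rewrite mulr_gt0.
(* As [d] and [M] are fixed, finitely many mesh points share one threshold [H], and the tolerance
   may be [r * d]. *)
have [|H [H0 HP]] := @finite_small R (fun i h => exists w : X,
    sumsn (s ++ s1) (w - T (i%:R * d) g) <= r * d /\
    sumsn (s ++ s1) (F h w - w - h *.: T (i%:R * d) (Z g)) <= r * d * h)
    M.*2.+1.
  move=> i _.
  have [Zi <-] := generator_comm p_gen X_hausdorff T_semigroup Z_gen Zg
    (mulr_ge0 (ler0n R i) (ltW d0)).
  exact: (core_consistent p_gen D_core F0 F_mef (s ++ s1) Zi rd0).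
set C := sumsn s2 (Z g); have C0 : 0 <= C by exact: sumsn_ge0.
pose h0 := Num.min H (Num.min (d / (2 * M.+1%:R)) (r * d / (C + 1))).
have C10 : 0 < C + 1 by rewrite ltr_wpDl.
have M20 : 0 < 2 * M.+1%:R :> R by rewrite mulr_gt0.
have h00 : 0 < h0 by rewrite !lt_min H0 !divr_gt0.
(* This gives [t0 / n < h0], hence [t / n < h0] for all [t] in the interval at once. *)
exists (Num.truncn (t0 / h0)).+1 => n nN t /andP[t_ge0 tt0].
(* Consistency concerns only steps [h > 0]; at [t = 0] every iterate is the identity. *)
have [->|t_neq0] := eqVneq t 0.
  have -> : iter n (F (0 / n%:R)) g = g.
    by rewrite mul0r F0; elim: n {nN} => //= n ->.
  by rewrite (semigroup0 T_semigroup) subrr sumsn0.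
have n0 : (0 < n)%N by exact: leq_trans nN.
have t_gt0 : 0 < t by rewrite lt_def t_neq0.
set h := t / n%:R.
have h_gt0 : 0 < h by rewrite divr_gt0// ltr0n.
have : h < h0.
  rewrite ltr_pdivrMr ?ltr0n// (le_lt_trans tt0)// mulrC -ltr_pdivrMr//.
  by apply: lt_le_trans (truncnS_gt _) _; rewrite ler_nat.
rewrite !lt_min => /and3P[hH].
rewrite (ltr_pdivlMr _ _ M20) (ltr_pdivlMr _ _ C10) => hM hC.
have hHP : 0 < h < H by rewrite h_gt0.
have /choice[w wP] : forall i, exists w, (i <= M.*2.+1)%N ->
    sumsn (s ++ s1) (w - T (i%:R * d) g) <= r * d /\
    sumsn (s ++ s1) (F h w - w - h *.: T (i%:R * d) (Z g)) <= r * h.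
  move=> i; have [iM|iM] := leqP i M.*2.+1; last by exists 0.
  have [w [w1 w2]] := HP h hHP i iM; exists w => _; split=> //.
  apply: le_trans w2 _; rewrite ler_pM2r// -[X in _ <= X]mulr1 ler_pM2l//.
  exact: ltW.
apply: (@le_lt_trans _ _ ((12 * t0 + 6) * r)); last first.
  by rewrite /r mulrC divfK ?gt_eqF//; lra.
apply: (chernoff_estimate p_gen T_semigroup (s1 := s1) (s2 := s2) (d := d)
  (M := M) (w := w) (z := Z g)) => //.
- exact: ltW.
- by move=> u u0; exact: (calE_linear F_calE u0).
- by move=> u /andP[u0 ud]; apply/ltW/d1P; rewrite u0 (le_lt_trans ud).
- by move=> u /andP[u0 ud]; apply/ltW/d2P; rewrite u0 (le_lt_trans ud).
- have := d3P d; rewrite d0 d_d3 => /(_ isT)/ltW.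
  have -> : T d g - g - d *.: Z g = d *.: (of_real k d^-1 *: (T d g - g) - Z g).
    by rewrite [RHS]rscaleBr rscaleA mulfV ?gt_eqF// rscale1.
  by move=> quot; rewrite sumsnZ// gtr0_norm// mulrC ler_pM2r.
- by rewrite t_gt0.
- exact: ltW.
- by apply: le_trans (ltW hC); rewrite ler_pM2l// lerDl.
Qed.

(** The operators [iter n (F (t / n%:R))] and [T t] are equicontinuous for [t] in [[0, t0]], so
    convergence passes from the dense domain of [Z] to every [f], at three costs of [e / 3]. *)
Lemma chernoff (X_complete : sequentially_complete X) (t0 : R) f s e :
  0 < t0 -> 0 < e ->
  exists N, forall n, (N <= n)%N -> forall t, 0 <= t <= t0 ->
    sumsn s (iter n (F (t / n%:R)) f - T t f) < e.
Proof.
move=> t00 e0; have e30 : 0 < e / 3 by rewrite divr_gt0.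
have [s1 FP] := calE_sumsn p_gen s F_calE (ltW t00).
have [s2 TP] := semigroup_sumsn p_gen T_semigroup s (ltW t00).
have [g [Zg gf]] :=
  generator_dense p_gen X_complete T_semigroup f (s1 ++ s2) e30.
have {}Zg : op_dom Z g by rewrite Z_gen.1.
have [N NP] := chernoff_on_domain s t00 Zg e30.
exists (maxn N 1) => n; rewrite geq_max => /andP[nN n0] t tt0.
have t_ge0 : 0 <= t by case/andP: tt0.
have Fl := linear_iter (calE_linear F_calE (divr_ge0 t_ge0 (ler0n R n))) n.
have Fgf := FP _ _ _ n0 (leqnn n) tt0 (f - g).
have Tgf := TP _ tt0 (g - f).
rewrite (linearB_of Fl) (sumsnC p_gen s1) in Fgf.
rewrite (linearB_of (semigroup_linear T_semigroup t_ge0)) in Tgf.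
have := NP n nN t tt0; rewrite sumsn_cat in gf.
have := sumsn_dist p_gen s (iter n (F (t / n%:R)) f)
  (iter n (F (t / n%:R)) g) (T t f).
have := sumsn_dist p_gen s (iter n (F (t / n%:R)) g) (T t g) (T t f).
have := sumsn_ge0 p_gen s1 (g - f); have := sumsn_ge0 p_gen s2 (g - f).
by lra.
Qed.

End Convergence.

Theorem theorem6p1 (R : realType) (k : scalars)
    (X : tvsType (scalar_field R k)) (Omega : Type) (p : Omega -> X -> R)
    (p_gen : generated_by p) (X_hausdorff : hausdorff_space X)
    (X_complete : sequentially_complete X)
    (Z : operator X) (expZ : R -> X -> X)
    (expZ_semigroup : lC0_semigroup p expZ) (Z_gen : is_generator expZ Z)
    (D : set X) (D_core : is_core Z D)
    (F : R -> X -> X) (F_calF : calF p F)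
    (D_dom : D `<=` op_dom (effective_derivative F))
    (F_ef : forall f, D f -> effective_derivative F f = Z f) :
  forall (f : X) (t0 : R), 0 < t0 ->
    {uniform `[0, t0],
      (fun (n : nat) (t : R) => iter n (F (t / n%:R)) f) @ \oo -->
      (fun t : R => expZ t f)}.
Proof.
move=> f t0 t00 A /uniform_nbhs[E [/(entourage_sumsn p_gen)[s [e [e0 sE]]] EA]].
(* By [D_dom] the set [mef F g] is inhabited, so [xget] returns one of its elements and not the
   default [0]. *)
have F_mef g : D g -> mef F g (Z g).
  by move=> Dg; rewrite -F_ef//=; have [y] := D_dom g Dg; exact: xgetI.
have [N NP] := chernoff p_gen X_hausdorff expZ_semigroup Z_gen F_calF.1 D_core
  F_mef X_complete f s t00 e0.
exists N => // n /= nN; apply: EA => t /=; rewrite in_itv /= => tt0.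
by apply: sE; rewrite /= (sumsnC p_gen); exact: NP.
Qed.
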